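(* Let $\langle \mathbf{V}=\{\mathbf{X},Y\},\mathbf{U},\mathcal{F},P_{\mathbf{u}}\rangle$ be an SCM with treatments $\mathbf{X}=\{X_1,\dots,X_n\}$ and outcome $Y$, where $X_i=f_i(Pa(X_i))+U_i$ for $i=1,\dots,n$, $Y=f_Y(\mathbf{X})+U_Y$, and $P_{\mathbf{u}}\sim\mathcal{N}(\mu,\Sigma)$. Then, for every $\mathbf{W}\subseteq\mathbf{X}$, the estimand $\mathbb{E}[Y\mid do(\mathbf{W})]$ is identifiable from the observational distribution together with any collection of interventional distributions that includes $P[Y\mid do(\mathbf{X})]$ and $\{P[\mathbf{V}\setminus Pa(X_i)\mid do(Pa(X_i))] : i=1,\dots,n\}$.
   Context: A structural causal model (SCM) $\mathcal{M}=\langle\{\mathbf{X},Y\},\mathbf{U},\mathcal{F},P_{\mathbf{u}}\rangle$ consists of observed variables (real-valued treatments $\mathbf{X}=\{X_1,\dots,X_n\}$ and a real-valued outcome $Y$), unobserved noise variables $\mathbf{U}=(U_1,\dots,U_n,U_Y)$ with joint distribution $P_{\mathbf{u}}$, and deterministic structural equations $\mathcal{F}$. Its causal graph $G$ is the directed graph on $\mathbf{V}=\{\mathbf{X},Y\}$ with an edge from each variable in $Pa(V)$ to $V$; it is acyclic. No treatment is a descendant of $Y$, so $Pa(X_i)\subseteq\mathbf{X}$, and all treatments are taken to be parents of $Y$. The model is a confounded additive noise model (ANM) with Gaussian noise: each variable is a deterministic function ($f_i$, $f_Y$) of its parents plus its noise term, and $\mathbf{U}$ is jointly Gaussian $\mathcal{N}(\mu,\Sigma)$;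 the components of $\mathbf{U}$ may be correlated and $\mu$ need not be zero. An intervention $do(\mathbf{W}=\mathbf{w})$ replaces the structural equations of the variables in $\mathbf{W}$ by the constants $\mathbf{w}$, leaving everything else (including $P_{\mathbf{u}}$) unchanged. $P[\mathbf{V}\setminus\mathbf{W}\mid do(\mathbf{W})]$ denotes the resulting joint distribution of the remaining variables, for all values $\mathbf{w}$; $do(\emptyset)$ gives the observational distribution. $\mathbb{E}[Y\mid do(\mathbf{W})]$ (the average causal effect, ACE) is the mean of $Y$ under $do(\mathbf{W}=\mathbf{w})$, as a function of $\mathbf{w}$. Identifiability: given the causal graph $G$ and a collection of interventional distributions, a quantity is not identifiable if and only if there exist two models $\mathcal{M}_1,\mathcal{M}_2$ in the class considered (here, SCMs with $X_i=f_i(Pa(X_i))+U_i$ for $i=1,\dots,n$, $Y=f_Y(\mathbf{X})+U_Y$, and $(U_1,\dots,U_n,U_Y)$ jointly Gaussian with arbitrary mean and covariance) that both have causal graph $G$ and both entail all the distributions in the collection, but assign different values to the quantity. Otherwise it is identifiable, i.e. any two models of the class with graph $G$ agreeing on the collection agree on the quantity. *)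

(* Defs.v *)
From HB Require Import structures.
From mathcomp Require Import all_boot all_order all_algebra.
From mathcomp Require Import all_classical all_reals all_analysis.

Set Implicit Arguments.
Unset Strict Implicit.
Unset Printing Implicit Defensive.

Import Order.TTheory GRing.Theory Num.Theory.
Import numFieldNormedType.Exports.

Local Open Scope classical_set_scope.
Local Open Scope ring_scope.

Definition cylinders (R : realType) (J : Type) : set_system (J -> R) :=
  [set A | exists j (B : set R),
    measurable B /\ A = (fun x : J -> R => x j) @^-1` B].

(* For finite J the cylinder sigma-algebra is the Borel sigma-algebra of R^J. *)
Notation vec R J := (g_sigma_algebraType (@cylinders R J)).

Lemma measurable_coord (R : realType) (J : Type) (j : J) :
  measurable_fun [set: vec R J] (fun x : vec R J => x j : R).
Proof.
by move=> _ B mB; rewrite setTI; apply: sub_sigma_algebra; exists j, B.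
Qed.

Lemma measurable_vec (R : realType) (J : Type) d (T : measurableType d)
    (f : T -> vec R J) :
  (forall j, measurable_fun [set: T] (fun t => f t j : R)) ->
  measurable_fun [set: T] f.
Proof.
move=> mf; apply: (@measurability _ _ _ (vec R J) _ _ (@cylinders R J)) => //.
move=> _ [_ [j [B [mB ->]]] <-].
exact: (mf j measurableT B mB).
Qed.

Definition restr (R : realType) (V : finType) (S : {set V}) (x : vec R V) :
  vec R {v | v \in S} := fun v => x (val v).
Arguments restr {R V} S x.

Lemma measurable_restr (R : realType) (V : finType) (S : {set V}) :
  measurable_fun [set: vec R V] (restr S).
Proof. by apply: measurable_vec => v; exact: measurable_coord. Qed.

(* [normal_prob m 0] is the uniform law on [0, 1], hence the case split. *)
Definition gaussian1 (R : realType) (m s2 : R) (A : set R) : \bar R :=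
  if s2 == 0 then \d_m A else normal_prob m (Num.sqrt s2) A.

(* The law N(mu, Sigma), possibly degenerate: every linear combination
   sum_j a_j U_j has law N(<a, mu>, <a, Sigma a>).  Measures are only
   constrained by the library on measurable sets, so laws are compared there. *)
Definition gaussian (R : realType) (J : finType) (mu : J -> R)
    (Sigma : J -> J -> R) (P : probability (vec R J) R) : Prop :=
  [/\ forall i j, Sigma i j = Sigma j i,
      forall a : J -> R, 0 <= \sum_i \sum_j a i * Sigma i j * a j
    & forall (a : J -> R) (A : set R), measurable A ->
        P [set u | A (\sum_j a j * u j)] =
        gaussian1 (\sum_j a j * mu j)
                  (\sum_i \sum_j a i * Sigma i j * a j) A].

(* [Some i] is the treatment X_i, [None] is the outcome Y. *)
Definition var (n : nat) : finType := option 'I_n.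

Definition treatments (n : nat) : {set var n} := [set~ None].

Record causal_graph (n : nat) := CausalGraph {
  edge : rel (var n);
  edge_acyclic : forall u v, edge u v -> ~~ connect edge v u;
  outcome_no_treatment_descendant : forall i, ~~ connect edge None (Some i);
  treatment_outcome_edge : forall i, edge (Some i) None }.

Definition Pa (n : nat) (G : causal_graph n) (v : var n) : {set var n} :=
  [set u | edge G u v].

Record anm (R : realType) (n : nat) (G : causal_graph n) := ANM {
  mech : forall v, {mfun vec R {u | u \in Pa G v} >-> R};
  noise_mean : var n -> R;
  noise_cov : var n -> var n -> R;
  noise : probability (vec R (var n)) R;
  noise_gaussian : gaussian noise_mean noise_cov noise }.

Section solution.
Variables (R : realType) (n : nat) (G : causal_graph n) (M : anm R G).
Variables (W : {set var n}) (w : var n -> R).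

(* Right-hand sides of the structural equations after do(W = w), at noise u;
   only the values of w on W matter. *)
Definition structural (u x : vec R (var n)) : vec R (var n) :=
  fun v => if v \in W then w v else mech M v (restr (Pa G v) x) + u v.

(* The graph being acyclic, #|V| rounds of substitution reach the solution of
   the structural equations from any starting point: see [solutionP]. *)
Definition solution (u : vec R (var n)) : vec R (var n) :=
  iter #|var n| (structural u) (fun=> 0).

Let anc (v : var n) : {set var n} := [set a | connect (edge G) a v].

Let anc_lt u v : edge G u v -> (#|anc u| < #|anc v|)%N.
Proof.
move=> uv; apply: proper_card; apply/properP; split.
  by apply/fintype.subsetP => a; rewrite !inE => /connect_trans; apply; exact: connect1.
by exists v; rewrite !inE ?connect0// edge_acyclic.
Qed.

Let iter_structural u k x y v : (#|anc v| <= k)%N ->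
  iter k (structural u) x v = iter k (structural u) y v.
Proof.
elim: k v => [|k ih] v.
  by rewrite leqn0 cards_eq0 => /eqP/setP/(_ v); rewrite !inE connect0.
move=> vk; rewrite !iterS /structural; case: ifPn => // _.
congr (mech M v _ + _); apply/funext => -[a pa]; rewrite /restr /=.
apply: ih; rewrite -ltnS; apply: leq_trans vk; apply: anc_lt.
by move: pa; rewrite inE.
Qed.

Lemma solutionP (u x : vec R (var n)) : structural u x = x <-> x = solution u.
Proof.
have it y z : iter #|var n| (structural u) y = iter #|var n| (structural u) z.
  by apply/funext => v; apply: iter_structural; exact: max_card.
split=> [fx|->].
  by rewrite /solution -(it x); elim: #|var n| => //= k <-.
by rewrite /solution -iterS iterSr; exact: it.
Qed.

Lemma measurable_solution : measurable_fun [set: vec R (var n)] solution.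
Proof.
rewrite /solution; elim: #|var n| => [|k ih]; first exact: measurable_cst.
apply: measurable_vec => v; rewrite /= /structural.
case: (v \in W); first exact: measurable_cst.
apply: measurable_realfun.measurable_funD; last exact: measurable_coord.
apply: measurableT_comp => //.
exact: measurableT_comp (@measurable_restr _ _ _) ih.
Qed.

Definition observed (S : {set var n}) (u : vec R (var n)) :
  vec R {v | v \in S} := restr S (solution u).
Arguments observed : clear implicits.

Lemma measurable_observed (S : {set var n}) :
  measurable_fun [set: vec R (var n)] (observed S).
Proof. exact: measurableT_comp (@measurable_restr _ _ _) measurable_solution. Qed.

HB.instance Definition _ (S : {set var n}) :=
  isMeasurableFun.Build _ _ _ _ (observed S) (@measurable_observed S).

(* P[S | do(W = w)] *)
Definition do_law (S : {set var n}) : probability (vec R {v | v \in S}) R :=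
  distribution (noise M) (observed S).

End solution.
Arguments observed {R n G} M W w S u.

(* E[Y | do(W)], as a function of the values w.  The integral is finite exactly
   when Y is integrable under do(W = w). *)
Definition ACE (R : realType) (n : nat) (G : causal_graph n) (M : anm R G)
    (W : {set var n}) : (var n -> R) -> \bar R :=
  fun w => 'E_(noise M)[fun u => solution M W w u None]%E.

(* (S, W) \in C stands for P[S | do(W)], for all values w. *)
Definition agree (R : realType) (n : nat) (G : causal_graph n)
    (C : set ({set var n} * {set var n})) (M1 M2 : anm R G) : Prop :=
  forall S W, C (S, W) -> forall (w : var n -> R) A, measurable A ->
    do_law M1 W w S A = do_law M2 W w S A.

Definition identifiable (R : realType) (n : nat) (G : causal_graph n)
    (C : set ({set var n} * {set var n})) (T : Type) (Q : anm R G -> T) : Prop :=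
  forall M1 M2 : anm R G, agree C M1 M2 -> Q M1 = Q M2.

(* Main.v *)
(** P[X_i | do(Pa(X_i) = p)] is the law of [f_i p + U_i].  If two models agree on
    it for all [p], the law of [U_i] is invariant under translation by
    [(f_i - f_i') p - (f_i - f_i') p0], which must vanish since no probability on
    the line is invariant under a nonzero translation.  So the mechanisms agree
    up to constants, which can be moved into the noise.  As the noise is then the
    residual of the observed vector, [Y] under do(W = w) is, in both models, the
    same measurable function of the observational vector, and has the same mean. *)

Require Import Defs.
From HB Require Import structures.
From mathcomp Require Import all_boot all_order all_algebra.
From mathcomp Require Import all_classical all_reals all_analysis.
From mathcomp Require Import measurable_realfun ring.
Import Order.TTheory GRing.Theory Num.Theory.
Import numFieldNormedType.Exports.
Local Open Scope classical_set_scope.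
Local Open Scope ring_scope.

(** Invariance makes the cdf [c]-periodic. A periodic monotone function is constant, which
    contradicts the limits 0 and 1 at the two infinities. *)
Lemma shift_invariant_law_eq0 {R : realType} d (T : measurableType d)
    (P : probability T R) (X : {RV P >-> R}) (c : R) :
  (forall A : set R, measurable A -> P (X @^-1` A) = P [set t | A (X t + c)]) ->
  c = 0.
Proof.
move=> Xc; have cdfD r : cdf X r = cdf X (r - c).
  rewrite /cdf /distribution /pushforward Xc//; congr (P _).
  by apply/seteqP; split=> t /=; rewrite !in_itv/= lerBrDr.
have cdfM k r : cdf X r = cdf X (r - k%:R * c).
  elim: k => [|k ->]; first by rewrite mul0r subr0.
  by rewrite cdfD -addrA -opprD -natr1 mulrDl mul1r.
have cdf_const r s : c != 0 -> r <= s -> cdf X r = cdf X s.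
  move=> c0 rs; apply/eqP; rewrite eq_le cdf_nondecreasing//=.
  have [k sk] : exists k : nat, s - k%:R * `|c| <= r.
    (* Enough periods to cover the distance from [r] to [s]; the sign of [c] then decides whether
       [r] is moved above [s] or [s] below [r]. *)
    exists (Num.truncn ((s - r) / `|c|)).+1.
    rewrite lerBlDr -lerBlDl -ler_pdivrMr ?normr_gt0//.
    exact/ltW/truncnS_gt.
  have [cn|cp|] := ltgtP c 0; last by move=> c1; rewrite c1 eqxx in c0.
  - rewrite (cdfM k r) cdf_nondecreasing//.
    by rewrite lerBrDr; move: sk; rewrite ltr0_norm// mulrN opprK.
  - by rewrite (cdfM k s) cdf_nondecreasing// -(gtr0_norm cp).
apply/eqP/negPn/negP => c0.
have cdfE : cdf X = cst (cdf X 0).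
  apply/funext => r /=.
  by have [r0|/ltW r0] := leP r 0; [|symmetry]; exact: cdf_const.
have lim_cdf (F : set_system R) (PF : ProperFilter F) l :
    cdf X @ F --> l -> cdf X 0 = l.
  by move=> /(cvg_lim (@ereal_hausdorff R)) <-; rewrite cdfE lim_cst.
have cdf01 : cdf X 0 = 1%E := lim_cdf _ _ _ (cvg_cdfy1 X).
have : 1%E = 0%E :> \bar R by rewrite -cdf01; exact: lim_cdf (cvg_cdfNy0 X).
by case=> /eqP; rewrite oner_eq0.
Qed.

(** Positive and negative parts are transferred separately, so the equality also covers infinite
    integrals, as [ACE] requires. *)
Lemma eq_law_integral {R : realType} d d1 d2 (T : measurableType d)
    (T1 : measurableType d1) (T2 : measurableType d2)
    (P1 : probability T1 R) (P2 : probability T2 R)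
    (X1 : {RV P1 >-> T}) (X2 : {RV P2 >-> T}) (f : T -> \bar R) :
  measurable_fun [set: T] f ->
  (forall A, measurable A -> distribution P1 X1 A = distribution P2 X2 A) ->
  (\int[P1]_t (f \o X1) t = \int[P2]_t (f \o X2) t)%E.
Proof.
move=> mf eqX.
have ge0_eq (g : T -> \bar R) : measurable_fun [set: T] g ->
    (forall x, 0 <= g x)%E -> (\int[P1]_t (g \o X1) t = \int[P2]_t (g \o X2) t)%E.
  move=> mg g0.
  rewrite -(ge0_integral_distribution X1)// -(ge0_integral_distribution X2)//.
  by apply: eq_measure_integral => A mA _; exact: eqX.
rewrite [LHS]integralE [RHS]integralE.
rewrite (funepos_comp f X1) (funepos_comp f X2).
rewrite (funeneg_comp f X1) (funeneg_comp f X2).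
congr (_ - _)%E.
- by apply: ge0_eq => //; exact: measurable_funepos.
- by apply: ge0_eq => //; exact: measurable_funeneg.
Qed.

Section anm.
Context {R : realType} {n : nat} {G : causal_graph n}.
Implicit Types (M : anm R G) (W S : {set var n}) (w : var n -> R).

Lemma edge_irrefl (v : var n) : edge G v v = false.
Proof. by apply/negP => vv; have := edge_acyclic vv; rewrite connect0. Qed.

Lemma Pa_outcome : Pa G None = treatments n.
Proof.
apply/setP => -[i|]; first by rewrite !inE treatment_outcome_edge.
by rewrite !inE edge_irrefl.
Qed.

Lemma solutionE M W w u v :
  solution M W w u v = if v \in W then w v
    else mech M v (restr (Pa G v) (solution M W w u)) + u v.
Proof.
by have /(congr1 (@^~ v)) := (solutionP M W w u (solution M W w u)).2 erefl.
Qed.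

Definition residual M (x : vec R (var n)) : vec R (var n) :=
  fun v => x v - mech M v (restr (Pa G v) x).

Lemma measurable_residual M : measurable_fun [set: vec R (var n)] (residual M).
Proof.
apply: measurable_vec => v; apply: measurable_realfun.measurable_funB.
  exact: measurable_coord.
apply: measurableT_comp => //; exact: measurable_restr.
Qed.

Lemma residual_solution M w u :
  residual M (solution M finset.set0 w u) = u.
Proof.
by apply/funext => v; rewrite /residual [X in X - _]solutionE inE addrAC subrr add0r.
Qed.

(** The solution in [M1] at noise [u] solves the equations of [M2] at noise [u + e], and that
    solution is unique by [solutionP]. *)
Lemma solution_shift {M1 M2} {e : var n -> R} :
  (forall v p, mech M1 v p = mech M2 v p + e v) ->
  forall W w u, solution M1 W w u = solution M2 W w (fun v => u v + e v).
Proof.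
move=> M12 W w u; apply/solutionP/funext => v.
by rewrite /structural [RHS]solutionE M12; case: ifP => // _; rewrite addrA addrAC.
Qed.

(** With its parents held at [w], the variable [v] is a constant plus its noise, and its law is a
    marginal of the given one. *)
Lemma mech_do_law M1 M2 S W w v : (v \in S) -> (v \notin W) ->
  Pa G v \subset W ->
  (forall A, measurable A -> do_law M1 W w S A = do_law M2 W w S A) ->
  forall A : set R, measurable A ->
    noise M1 [set u | A (mech M1 v (restr (Pa G v) w) + u v)] =
    noise M2 [set u | A (mech M2 v (restr (Pa G v) w) + u v)].
Proof.
move=> vS vW PaW M12 A mA.
have lawE M : noise M [set u | A (mech M v (restr (Pa G v) w) + u v)] =
    do_law M W w S [set x | A (x (Sub v vS))].
  congr (noise M _).
  suff E u : observed M W w S u (Sub v vS) =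
             mech M v (restr (Pa G v) w) + u v.
    by apply/seteqP; split => u /=; rewrite E.
  rewrite /observed /restr /= solutionE (negbTE vW); congr (mech M v _ + _).
  apply/funext => -[a ap]; rewrite /restr /=.
  by rewrite solutionE (fintype.subsetP PaW _ ap).
rewrite !lawE; apply: M12.
by rewrite -[X in measurable X]setTI; exact: measurable_coord.
Qed.

Lemma mech_eq_shift M1 M2 S v : v \in S ->
  (forall w A, measurable A ->
    do_law M1 (Pa G v) w S A = do_law M2 (Pa G v) w S A) ->
  exists e, forall p, mech M1 v p = mech M2 v p + e.
Proof.
move=> vS M12.
(* Padding by 0 off the parents turns a parent assignment into intervention values; [restr] undoes
   it. *)
pose extend (p : vec R {u | u \in Pa G v}) : var n -> R :=
  fun u => oapp p 0 (insub u).
have extendK p : restr (Pa G v) (extend p) = p.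
  by apply/funext => u; rewrite /restr /extend valK.
have law p A : measurable A -> noise M1 [set u | A (mech M1 v p + u v)] =
    noise M2 [set u | A (mech M2 v p + u v)].
  move=> mA; rewrite -(extendK p).
  apply: (@mech_do_law M1 M2 S (Pa G v)) => //; last exact: M12.
  by rewrite inE edge_irrefl.
(* An arbitrary reference point, at which the constant [e] is read off. *)
pose p0 : vec R {u | u \in Pa G v} := fun=> 0.
exists (mech M1 v p0 - mech M2 v p0) => p.
pose c := mech M1 v p - mech M2 v p - (mech M1 v p0 - mech M2 v p0).
suff c0 : c = 0 by apply/eqP; rewrite addrC -subr_eq; apply/eqP/subr0_eq.
pose X (u : vec R (var n)) : R := u v.
pose mX := isMeasurableFun.Build _ _ _ _ X (measurable_coord (R := R) v).
pose rvX : {RV noise M1 >-> R} := HB.pack X mX.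
apply: (@shift_invariant_law_eq0 _ _ _ (noise M1) rvX) => A mA.
have law_shift p' b :
    noise M1 [set u | A (mech M1 v p' + u v + b)] =
    noise M2 [set u | A (mech M2 v p' + u v + b)].
  apply: (law p' [set y | A (y + b)]).
  rewrite -[X in measurable X]setTI.
  have mD : measurable_fun [set: R] (fun y => y + b) by exact: measurable_funD.
  exact: mD.
have setE (f g : vec R (var n) -> R) : f =1 g ->
  [set u | A (f u)] = [set u | A (g u)] by move=> /funext ->.
(* Under [noise M1], both [u v] and [u v + c] turn out to have the law of [u v + a] under
   [noise M2]: the first by comparing the models at [p0], the second at [p]. *)
pose a := mech M2 v p0 - mech M1 v p0.
rewrite [RHS](_ : _ =
  noise M1 [set u | A (mech M1 v p + u v + (a - mech M2 v p))]); last first.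
  congr (noise M1 _); apply: setE => u; rewrite /= /X /c /a; ring.
rewrite [LHS](_ : _ =
  noise M1 [set u | A (mech M1 v p0 + u v + - mech M1 v p0)]); last first.
  congr (noise M1 _); apply: setE => u; rewrite /= /X; ring.
rewrite !law_shift; congr (noise M2 _); apply: setE => u; rewrite /a; ring.
Qed.

End anm.

Theorem theorem1 (R : realType) (n : nat) (G : causal_graph n)
    (C : set ({set var n} * {set var n}))
    (observational : C ([set: var n]%SET, finset.set0))
    (treatments_do : C ([set None]%SET, treatments n))
    (parents_do : forall i : 'I_n,
       C ((~: Pa G (Some i))%SET, Pa G (Some i)))
    (W : {set var n}) (WX : W \subset treatments n) :
  identifiable C (fun M : anm R G => ACE M W).
Proof.
move=> M1 M2 M12.
have shift v : exists e, forall p, mech M1 v p = mech M2 v p + e.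
  (* A treatment uses the intervention on its parents; the outcome uses the one on all treatments,
     which are its parents. *)
  case: v => [i|].
    apply: (@mech_eq_shift _ _ _ _ _ (~: Pa G (Some i))%SET).
      by rewrite !inE edge_irrefl.
    exact: M12.
  apply: (@mech_eq_shift _ _ _ _ _ [set None]%SET); first by rewrite inE.
  by rewrite Pa_outcome; exact: M12.
have [e mech12] := choice shift.
apply/funext => w; rewrite /ACE unlock.
pose full (x : vec R {v | v \in [set: var n]%SET}) : vec R (var n) :=
  fun v => x (Sub v (finset.in_setT v)).
(* Recover the noise from an observational vector through [M2], then replay it under the
   intervention. The same function serves both models. *)
pose Y x := (solution M2 W w (residual M2 (full x)) None)%:E.
have fullE (M : anm R G) u : full (observed M finset.set0 w [set: var n]%SET u) =
    solution M finset.set0 w u by [].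
(* On data from [M1] the recovered noise is [u + e], and replaying it in [M2] gives the outcome of
   [M1] at [u]. *)
have Y1 u : Y (observed M1 finset.set0 w [set: var n]%SET u) =
    (solution M1 W w u None)%:E.
  by rewrite /Y fullE !(solution_shift mech12) residual_solution.
have Y2 u : Y (observed M2 finset.set0 w [set: var n]%SET u) =
    (solution M2 W w u None)%:E.
  by rewrite /Y fullE residual_solution.
transitivity (\int[noise M1]_u Y (observed M1 finset.set0 w [set: var n]%SET u))%E.
  by apply: eq_integral => u _; rewrite Y1.
transitivity (\int[noise M2]_u Y (observed M2 finset.set0 w [set: var n]%SET u))%E;
  last by apply: eq_integral => u _; rewrite Y2.
apply: (@eq_law_integral _ _ _ _ _ _ _ (noise M1) (noise M2)
  (observed M1 finset.set0 w [set: var n]%SET)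
  (observed M2 finset.set0 w [set: var n]%SET) Y); last exact: M12.
apply/measurable_EFinP.
have mfull : measurable_fun setT full.
  by apply: measurable_vec => v; exact: measurable_coord.
have msol := measurableT_comp (measurable_solution M2 W w)
  (measurableT_comp (measurable_residual M2) mfull).
exact: measurableT_comp (measurable_coord (R := R) (None : var n)) msol.
Qed.
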